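(* Let $n$ and $r$ be integers with $0\le r<n$, and put \[ \alpha_{n,r}=\frac{2^{n-1}}{\sum_{i=r+1}^{n}\binom{n}{i}}. \] Define $k=\lfloor \alpha_{n,r}\rfloor$ if $\alpha_{n,r}\notin\mathbb{Z}$, and $k=\alpha_{n,r}-1$ if $\alpha_{n,r}\in\mathbb{Z}$. Then the Vietoris--Rips complex $VR(Q_n;r)$ is $(k-1)$-connected.
   Context: $Q_n$ denotes the set $\{0,1\}^n$ of vertices of the $n$-dimensional hypercube, equipped with the Hamming distance $d_H$ (the number of coordinates in which two binary strings differ), which equals the shortest-path metric of the hypercube graph. For $r\ge 0$, the Vietoris--Rips complex $VR(Q_n;r)$ is the simplicial complex with vertex set $Q_n$ whose simplices are the finite subsets of $Q_n$ of diameter at most $r$ with respect to $d_H$. A simplicial complex is $k$-connected if its geometric realisation has $\pi_i=0$ for all $0\le i\le k$. The bracket $[\alpha]$ in the paper denotes the integer part $\lfloor\alpha\rfloor$. *)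

(* Defs.v *)
From HB Require Import structures.
From mathcomp Require Import all_boot all_order all_algebra.
From mathcomp Require Import all_classical all_reals all_analysis.

Set Implicit Arguments.
Unset Strict Implicit.
Unset Printing Implicit Defensive.

Import Order.TTheory GRing.Theory Num.Theory numFieldNormedType.Exports.

Local Open Scope classical_set_scope.
Local Open Scope ring_scope.

Section HomotopyGroups.
Variables (R : realType) (X : topologicalType) (i : nat).
Implicit Types f g : 'rV[R]_i -> X.

Definition cube : set 'rV[R]_i := [set t | forall j, 0 <= t ord0 j <= 1].

Definition cube_boundary : set 'rV[R]_i :=
  [set t | cube t /\ exists j, t ord0 j = 0 \/ t ord0 j = 1].

(* Maps (I^i, bd I^i) -> (X, x0). They are total functions on R^i of which only
   the restriction to the cube is relevant. *)
Definition cube_loop (x0 : X) f : Prop :=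
  {within cube, continuous f} /\ forall t, cube_boundary t -> f t = x0.

Definition cube_loop_homotopic (x0 : X) f g : Prop :=
  exists H : 'rV[R]_i * R -> X,
    [/\ {within cube `*` `[0, 1]%classic, continuous H},
        forall t, cube t -> H (t, 0) = f t,
        forall t, cube t -> H (t, 1) = g t &
        forall t s, cube_boundary t -> 0 <= s <= 1 -> H (t, s) = x0].

Definition loop_class (x0 : X) f : set ('rV[R]_i -> X) :=
  [set g | cube_loop x0 g /\ cube_loop_homotopic x0 f g].

(* The underlying set of pi_i(X, x0). For i = 0 the cube is a point with empty
   boundary, so this is the set of path components of X. *)
Definition homotopy_group (x0 : X) : set (set ('rV[R]_i -> X)) :=
  [set loop_class x0 f | f in cube_loop x0].

Definition homotopy_group_trivial (x0 : X) : Prop :=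
  homotopy_group x0 = [set loop_class x0 (cst x0)].

End HomotopyGroups.

(* k is an integer since k = -1 occurs; (-1)-connected means nonempty. *)
Definition k_connected (R : realType) (k : int) (X : topologicalType) : Prop :=
  [set: X] !=set0 /\
  forall i : nat, i%:Z <= k -> forall x0 : X, homotopy_group_trivial R i x0.

Record simplicial_complex (V : finType) := SimplicialComplex {
  simplices :> {set {set V}};
  simplex_neq0 : finset.set0 \notin simplices;
  simplex_vertex : forall v : V, [set v]%SET \in simplices;
  simplex_face : forall s t : {set V},
    s \in simplices -> t != finset.set0 -> t \subset s -> t \in simplices
}.

(* Barycentric coordinates; the vertex set being finite, the subspace topology
   inherited from R^V is the usual topology of the realisation. *)
Definition geometric_realisation (R : realType) (V : finType)
    (K : simplicial_complex V) : set (prod_topology (fun _ : V => R)) :=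
  [set t | [/\ forall v, 0 <= t v, \sum_(v : V) t v = 1 &
               [set v | t v != 0]%SET \in K]].

Arguments geometric_realisation R {V} K.

Section VietorisRips.
Variable n : nat.

Local Notation hypercube := (n.-tuple bool).

Definition hamming (x y : hypercube) : nat :=
  #|[set j | tnth x j != tnth y j]%SET|.

Definition diameter (s : {set hypercube}) : nat :=
  (\max_(x in s) \max_(y in s) hamming x y)%N.

Definition vr_simplices (r : nat) : {set {set hypercube}} :=
  [set s | (s != finset.set0) && (diameter s <= r)%N]%SET.

Lemma hammingxx x : hamming x x = 0%N.
Proof. by apply/eqP; rewrite cards_eq0; apply/eqP/setP => j; rewrite !inE eqxx. Qed.

Lemma vr_neq0 r : finset.set0 \notin vr_simplices r.
Proof. by rewrite inE eqxx. Qed.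

Lemma vr_vertex r v : [set v]%SET \in vr_simplices r.
Proof.
rewrite inE /diameter !finset.big_set1 hammingxx leq0n andbT.
by apply/set0Pn; exists v; rewrite finset.in_set1.
Qed.

Lemma vr_face r (s t : {set hypercube}) :
  s \in vr_simplices r -> t != finset.set0 -> t \subset s ->
  t \in vr_simplices r.
Proof.
rewrite !inE => /andP[_ ds] -> /fintype.subsetP ts /=.
apply/bigmax_leqP => x xt; apply/bigmax_leqP => y yt.
apply: leq_trans ds; rewrite /diameter.
apply: leq_trans (leq_bigmax_cond _ (ts x xt)).
exact: leq_bigmax_cond (ts y yt).
Qed.

Definition vietoris_rips (r : nat) : simplicial_complex hypercube :=
  SimplicialComplex (vr_neq0 r) (vr_vertex r) (@vr_face r).

End VietorisRips.

Definition alpha (n r : nat) : rat :=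
  (2 ^ n.-1)%N%:R / (\sum_(r.+1 <= i < n.+1) 'C(n, i))%N%:R.

Definition conn_index (n r : nat) : int :=
  if alpha n r \is a Num.int then Num.floor (alpha n r) - 1
  else Num.floor (alpha n r).

(* Main.v *)
Require Import Defs.
From HB Require Import structures.
From mathcomp Require Import all_boot all_order all_algebra.
From mathcomp Require Import all_classical all_reals all_analysis.
From mathcomp Require Import zify lra.

Import Order.TTheory GRing.Theory Num.Theory numFieldNormedType.Exports.

Local Open Scope classical_set_scope.
Local Open Scope ring_scope.

(** A set of vertices has a common neighbour in [VR(Q_n; r)] as soon as the sets
    of vertices at distance more than [r] from its members do not cover [Q_n];
    since [k < alpha], this holds for any [2k] vertices. It remains to see that
    a clique complex in which any [2d] vertices have a common neighbour is
    [(d-1)]-connected. The stars of its vertices cover it, and the intersection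
    of the stars of [t >= 2] vertices is the clique complex on their common
    neighbours, in which any [2d - t >= 2(d - t + 1)] vertices have a common
    neighbour; by induction it is [(d-t)]-connected, and the nerve lemma applies.

    The nerve lemma follows by adding the stars one at a time, from the gluing
    lemma: if [K], [L] are [(d-1)]-connected and [K cap L] is [(d-2)]-connected,
    then [K cup L] is [(d-1)]-connected. To extend a map from the boundary of the
    [d]-cube, push it off the frontier so that every small cube of a fine grid
    is sent into [K] or into [L], label all faces of the grid accordingly, and
    fill the faces by increasing dimension: those of dimension [d] carry a single
    label, and those with both labels have dimension at most [d-1]. *)

Set Implicit Arguments.
Unset Strict Implicit.
Unset Printing Implicit Defensive.

(** * Continuity on a subset *)

Definition cts_on (T U : topologicalType) (A : set T) (f : T -> U) : Prop :=
  forall x, A x -> f @ within A (nbhs x) --> f x.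

Section ContinuityOn.
Variables T U : topologicalType.
Implicit Types (A B : set T) (f g : T -> U).

Lemma cts_onP A f : cts_on A f <-> {within A, continuous f}.
Proof. by split=> /subspace_continuousP. Qed.

Lemma cts_onW A B f : A `<=` B -> cts_on B f -> cts_on A f.
Proof. by move=> AB /cts_onP cf; apply/cts_onP/(continuous_subspaceW AB). Qed.

Lemma cts_on_eq A f g : (forall x, A x -> f x = g x) -> cts_on A f -> cts_on A g.
Proof.
move=> fg cf x Ax; rewrite -fg//; apply: cvg_trans (cf x Ax).
apply: near_eq_cvg; rewrite near_withinE; apply: nearW => y Ay; exact: fg.
Qed.

Lemma cts_onU A B f : closed A -> closed B ->
  cts_on A f -> cts_on B f -> cts_on (A `|` B) f.
Proof.
by move=> cA cB /cts_onP cfA /cts_onP cfB; apply/cts_onP/withinU_continuous.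
Qed.

Lemma continuous_cts_on A f : continuous f -> cts_on A f.
Proof. by move=> cf; apply/cts_onP/continuous_subspaceT. Qed.

Lemma cts_on_setT f : cts_on setT f -> continuous f.
Proof. by move=> cf x; have := cf x Logic.I; rewrite withinET. Qed.

Lemma cts_on_comp (W : topologicalType) A (B : set U) (f : T -> U) (g : U -> W) :
  cts_on A f -> (forall x, A x -> B (f x)) -> cts_on B g -> cts_on A (g \o f).
Proof.
move=> cf fAB cg x Ax; apply: cvg_trans (cg _ (fAB _ Ax)).
move=> P; rewrite /within/= => /(cf x Ax) H.
move: H; rewrite /nbhs/= /within/=; apply: filterS => y H Ay.
by apply: H => //; apply: fAB.
Qed.

Lemma cts_on_pair (W : topologicalType) A f (g : T -> W) :
  cts_on A f -> cts_on A g -> cts_on A (fun x => (f x, g x)).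
Proof. by move=> cf cg x Ax; apply: cvg_pair; [apply: cf|apply: cg]. Qed.

End ContinuityOn.

Section ContinuityProd.
Variables (T : topologicalType) (I : eqType) (U : I -> topologicalType).
Implicit Types (A : set T) (f : T -> prod_topology U).

Lemma cts_on_prod A f :
  (forall i, cts_on A (fun x => f x i)) -> cts_on A f.
Proof.
move=> cf x Ax; apply/cvg_sup => i P [/= _ [[W oW <-] Wfx] WP].
have := cf i x Ax W; move/(_ (open_nbhs_nbhs (conj oW Wfx))).
move=> H; apply: (@filterS _ (within A (nbhs x)) _ _ _ _ H) => y; exact: WP.
Qed.

Lemma cts_on_proj A f i : cts_on A f -> cts_on A (fun x => f x i).
Proof.
move=> cf.
have /(cts_on_comp (g := fun h : prod_topology U => h i) cf) :
    forall x, A x -> setT (f x) by [].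
by apply; apply: continuous_cts_on; exact: proj_continuous.
Qed.

End ContinuityProd.

Section ContinuityReal.
Variables (R : realType) (T : topologicalType) (A : set T).
Implicit Types f g : T -> R.

Lemma cts_on_cst (U : topologicalType) (c : U) : cts_on A (fun _ => c).
Proof. by move=> x Ax; apply: cvg_cst. Qed.

Lemma cts_onD f g : cts_on A f -> cts_on A g -> cts_on A (fun x => f x + g x).
Proof. by move=> cf cg x Ax; apply: cvgD; [apply: cf|apply: cg]. Qed.

Lemma cts_onB f g : cts_on A f -> cts_on A g -> cts_on A (fun x => f x - g x).
Proof. by move=> cf cg x Ax; apply: cvgB; [apply: cf|apply: cg]. Qed.

Lemma cts_onM f g : cts_on A f -> cts_on A g -> cts_on A (fun x => f x * g x).
Proof. by move=> cf cg x Ax; apply: cvgM; [apply: cf|apply: cg]. Qed.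

Lemma cts_onV f : (forall x, A x -> f x != 0) -> cts_on A f ->
  cts_on A (fun x => (f x)^-1).
Proof. by move=> f0 cf x Ax; apply: cvgV; [apply: f0|apply: cf]. Qed.

Lemma cts_on_norm f : cts_on A f -> cts_on A (fun x => `|f x|).
Proof. by move=> cf x Ax; apply: cvg_norm; apply: cf. Qed.

Lemma cts_on_max f g : cts_on A f -> cts_on A g ->
  cts_on A (fun x => Num.max (f x) (g x)).
Proof.
move=> cf cg x Ax; under eq_fun do rewrite maxr_absE; rewrite maxr_absE.
apply: cvgMl; apply: cvgD; first by apply: cvgD; [apply: cf|apply: cg].
by apply: cvg_norm; apply: cvgB; [apply: cf|apply: cg].
Qed.

Lemma cts_on_sum (I : Type) (s : seq I) (f : I -> T -> R) :
  (forall i, cts_on A (f i)) -> cts_on A (fun x => \sum_(i <- s) f i x).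
Proof.
move=> cf; elim: s => [|i s IH].
  by under eq_fun do rewrite big_nil; apply: cts_on_cst.
by under eq_fun do rewrite big_cons; apply: cts_onD.
Qed.

Lemma cts_on_bigmax (I : Type) (s : seq I) (f : I -> T -> R) :
  (forall i, cts_on A (f i)) ->
  cts_on A (fun x => \big[Num.max/0]_(i <- s) f i x).
Proof.
move=> cf; elim: s => [|i s IH].
  by under eq_fun do rewrite big_nil; apply: cts_on_cst.
by under eq_fun do rewrite big_cons; apply: cts_on_max.
Qed.

End ContinuityReal.

(** * Cubes and their boundary spheres *)

Section Cubes.
Variable R : realType.
Local Notation E I := (prod_topology (fun _ : I => R)).

Lemma closed_le_cts (T : topologicalType) (f g : T -> R) :
  cts_on setT f -> cts_on setT g -> closed [set x | f x <= g x].
Proof.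
move=> cf cg;
  have /cts_on_setT/continuous_closedP/(_ _ (@closed_ge _ 0)) H := cts_onB cg cf.
have <- : (fun x => g x - f x) @^-1` [set y | 0 <= y] = [set x | f x <= g x].
  by apply/seteqP; split=> x /=; rewrite subr_ge0.
exact: H.
Qed.

Lemma coord_cts (I : eqType) (A : set (E I)) i : cts_on A (fun x => x i).
Proof. by apply: (@cts_on_proj _ I (fun _ => R) A id) => x Ax;
  apply: cvg_within. Qed.

Lemma nbhs_box (I : eqType) (x : E I) (P : set (E I)) : nbhs x P ->
  exists2 d : R, 0 < d & forall y, (forall i, `|x i - y i| < d) -> P y.
Proof.
pose F : set_system (E I) :=
  [set P | exists2 d : R, 0 < d & forall y, (forall i, `|x i - y i| < d) -> P y].
have FF : Filter F.
  split=> [|P1 P2 [d1 d10 H1] [d2 d20 H2]|P1 P2 P12 [d d0 H]].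
  - by exists 1.
  - exists (Num.min d1 d2); first by rewrite lt_min d10.
    move=> y H; split; [apply: H1|apply: H2] => i;
    by move: (H i); rewrite lt_min => /andP[].
  - by exists d => // y /H/P12.
suff : F --> x by apply.
apply/cvg_sup => i Q [/= _ [[W oW <-] Wx] WQ].
have /nbhs_ballP[d /= d0 dW] := open_nbhs_nbhs (conj oW Wx).
by exists d => // y H; apply: WQ => /=; apply: dW; apply: H.
Qed.

Lemma box_nbhs (I : finType) (x : E I) (d : R) : 0 < d ->
  \forall y \near x, forall i, `|x i - y i| < d.
Proof.
move=> d0.
apply: (@filter_forall _ _ (fun i y => `|x i - y i| < d) _ (nbhs_filter x)) => i.
have /(_ x Logic.I) := @coord_cts I setT i.
move=> /(_ [set z | `|x i - z| < d]); rewrite withinET; apply.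
by apply/nbhs_ballP; exists d.
Qed.

Definition unit_cube (I : finType) : set (E I) :=
  [set x | forall i, 0 <= x i <= 1].

Definition unit_sphere (I : finType) : set (E I) :=
  [set x | unit_cube x /\ exists i, x i = 0 \/ x i = 1].

(* The distance to the centre of the cube in the maximum norm, scaled so that
   the unit sphere is at distance 1. *)
Definition radius (I : finType) (x : E I) : R :=
  \big[Num.max/0]_i `|2 * x i - 1|.

Section Radius.
Variable I : finType.
Implicit Types x : E I.

Lemma radius_cts A : cts_on A (@radius I).
Proof.
apply: cts_on_bigmax => i; apply: cts_on_norm; apply: cts_onB;
  last exact: cts_on_cst.
by apply: cts_onM; [exact: cts_on_cst|exact: coord_cts].
Qed.

Lemma radius_ge x i : `|2 * x i - 1| <= radius x.
Proof. exact: (@le_bigmax _ _ _ 0 (fun i => `|2 * x i - 1|)). Qed.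

Lemma radius_attained x : 0 < radius x -> exists i, radius x = `|2 * x i - 1|.
Proof.
rewrite /radius; elim/big_rec: _ => [|i r _ IH]; first by rewrite ltxx.
rewrite /Num.max; case: ifP => // _ _; by exists i.
Qed.

Lemma unit_cubeE x : unit_cube x <-> radius x <= 1.
Proof.
split=> [Cx|rx i].
  apply: bigmax_le => // i _; rewrite ler_norml; have := Cx i; lra.
by have := le_trans (radius_ge x i) rx; rewrite ler_norml; lra.
Qed.

Lemma unit_sphereE x : unit_sphere x <-> radius x = 1.
Proof.
split=> [[/unit_cubeE Cx [i xi]]|rx].
  apply/le_anti; rewrite Cx /=; apply: le_trans (radius_ge x i).
  case: xi => ->; first by rewrite mulr0 sub0r normrN1.
  by rewrite (_ : 2 * 1 - 1 = 1) ?normr1//; lra.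
split; first by apply/unit_cubeE; rewrite rx.
have [|i] := @radius_attained x; first by rewrite rx.
rewrite rx => /esym/eqP; rewrite eqr_norml => /andP[/orP[]/eqP xi _]; exists i; lra.
Qed.

Lemma closed_unit_cube : closed (@unit_cube I).
Proof.
have -> : @unit_cube I = [set x | radius x <= 1].
  by apply/seteqP; split=> x /unit_cubeE.
apply: closed_le_cts; [exact: radius_cts|exact: cts_on_cst].
Qed.

Lemma closed_unit_sphere : closed (@unit_sphere I).
Proof.
have -> : @unit_sphere I = @unit_cube I `&` [set x | 1 <= radius x].
  apply/seteqP; split=> x; first by move=> /[dup]/unit_sphereE/= -> [].
  by move=> [/unit_cubeE r1 /= r2]; apply/unit_sphereE/le_anti; rewrite r1.
apply: closedI; first exact: closed_unit_cube.
by apply: closed_le_cts; [exact: cts_on_cst|exact: radius_cts].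
Qed.

Lemma compact_unit_sphere : compact (@unit_sphere I).
Proof.
apply: (@subclosed_compact _ _ (@unit_cube I)); first exact: closed_unit_sphere.
  have := @tychonoff I (fun _ => R) (fun _ => `[0, 1]%classic)
    (fun _ => @segment_compact R 0 1).
  have <- : [set x | forall i, `[0, 1]%classic (x i)] = @unit_cube I; last by apply.
  by apply/seteqP; split=> x H i; have := H i; rewrite /= in_itv.
by move=> x [].
Qed.

End Radius.

Lemma uniformly_cts_sphere (I V : finType) (f : E I -> E V) (e : R) :
  0 < e -> cts_on (@unit_sphere I) f ->
  exists2 d : R, 0 < d & forall x y, unit_sphere x -> unit_sphere y ->
    (forall i, `|x i - y i| < d) -> forall v, `|f x v - f y v| < e.
Proof.
move=> e0 cf.
have /compact_near_coveringP/near_covering_withinP := @compact_unit_sphere I.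
pose P (d : R) (x : E I) := forall y, unit_sphere y ->
  (forall i, `|x i - y i| < d) -> forall v, `|f x v - f y v| < e.
move=> /(_ R (0:R)^'+ P _).
have H x : unit_sphere x -> \forall x' \near x & d \near (0:R)^'+,
    unit_sphere x' -> P d x'.
  move=> Sx; have e20 : 0 < e / 2 by rewrite divr_gt0.
  have /nbhs_box[d d0 Hd] :
      nbhs x [set y | unit_sphere y -> forall v, `|f x v - f y v| < e / 2].
    exact: cf x Sx _ (box_nbhs (f x) e20).
  have d20 : 0 < d / 2 by rewrite divr_gt0.
  exists ([set x' | forall i, `|x i - x' i| < d / 2], [set d' | d' < d / 2]).
    by split; [exact: box_nbhs|exact: nbhs_right_lt].
  move=> [x' d'] /= [xx' dd'] Sx' y Sy x'y v.
  have fx' : `|f x v - f x' v| < e / 2.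
    by apply: Hd => // i; have := xx' i; lra.
  have fy : `|f x v - f y v| < e / 2.
    apply: Hd => // i; have -> : x i - y i = (x i - x' i) + (x' i - y i) by lra.
    by apply: le_lt_trans (ler_normD _ _) _; have := xx' i; have := x'y i; lra.
  have -> : f x' v - f y v = - (f x v - f x' v) + (f x v - f y v) by lra.
  by apply: le_lt_trans (ler_normD _ _) _; rewrite normrN; lra.
move=> /(_ H) /(filterI (nbhs_right_gt (0:R))) /filter_ex[d [d0 Hd]].
by exists d => // x y Sx; apply: Hd.
Qed.

Definition sphere_extendable (I : finType) (U : topologicalType) (X : set U) :=
  forall f : E I -> U, cts_on (@unit_sphere I) f ->
    (forall x, unit_sphere x -> X (f x)) ->
  exists g : E I -> U, [/\ cts_on (@unit_cube I) g,
    forall x, unit_cube x -> X (g x) & forall x, unit_sphere x -> g x = f x].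

(* This is (d - 1)-connectedness; the empty sphere of the 0-cube accounts for
   nonemptiness. *)
Definition spheres_extendable (d : nat) (U : topologicalType) (X : set U) :=
  forall I : finType, (#|I| <= d)%N -> sphere_extendable I X.

Lemma spheres_extendableW d d' (U : topologicalType) (X : set U) :
  (d' <= d)%N -> spheres_extendable d X -> spheres_extendable d' X.
Proof. by move=> d'd H I Id'; apply: H; apply: leq_trans d'd. Qed.

(* Fill the collar [1/2 <= radius <= 1] by the homotopy and the inner cube by
   the extension of its end. *)
Lemma homotopy_extension (I : finType) (U : topologicalType) (X : set U)
    (H : E I * R -> U) (g1 : E I -> U) :
  cts_on (@unit_sphere I `*` [set s : R | 0 <= s <= 1]) H ->
  (forall x s, unit_sphere x -> 0 <= s <= 1 -> X (H (x, s))) ->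
  cts_on (@unit_cube I) g1 -> (forall x, unit_cube x -> X (g1 x)) ->
  (forall x, unit_sphere x -> g1 x = H (x, 1)) ->
  exists g : E I -> U, [/\ cts_on (@unit_cube I) g,
    forall x, unit_cube x -> X (g x) & forall x, unit_sphere x -> g x = H (x, 0)].
Proof.
move=> cH HX cg1 g1X g1H.
pose inner (x : E I) : E I := fun i => 2 * x i - 2^-1.
pose outer (x : E I) : E I := fun i => 2^-1 + (2 * x i - 1) / (2 * radius x).
pose A : set (E I) := [set x | radius x <= 2^-1].
pose B : set (E I) := @unit_cube I `&` [set x | 2^-1 <= radius x].
have innerC x : A x -> unit_cube (inner x).
  move=> Ax i; have := le_trans (radius_ge x i) Ax.
  by rewrite ler_norml /inner; lra.
have outerS x : B x -> unit_sphere (outer x).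
  move=> [_ /= Bx]; have r0 : 0 < radius x by lra.
  split=> [i|].
    have : `|(2 * x i - 1) / (2 * radius x)| <= 2^-1.
      rewrite normrM normfV (gtr0_norm (_ : 0 < 2 * radius x)); last by lra.
      by rewrite ler_pdivrMr; [have := radius_ge x i; lra|lra].
    by rewrite ler_norml /outer; lra.
  have [i xi] := radius_attained r0; exists i; rewrite /outer xi.
  have r'0 : `|2 * x i - 1| != 0 by rewrite -xi gt_eqF.
  case: (lerP 0 (2 * x i - 1)) => [/ger0_norm|/ltr0_norm] nE; rewrite nE in r'0 *;
    [right|left].
  - by rewrite invfM mulrCA divff ?mulr1//; lra.
  - by rewrite mulrN invrN mulrN invfM mulrCA divff ?mulr1//; move: r'0;
    rewrite ?oppr_eq0//; lra.
pose g x := if radius x <= 2^-1 then g1 (inner x) else H (outer x, 2 - 2 *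
  radius x).
have gB x : B x -> H (outer x, 2 - 2 * radius x) = g x.
  move=> Bx; have [_ /= r2] := Bx; rewrite /g; case: ifPn => // r1.
  have rE : radius x = 2^-1 by apply/le_anti/andP.
  have oi : outer x = inner x.
    by apply/funext => i; rewrite /outer /inner rE divff ?divr1 ?pnatr_eq0//; lra.
  by rewrite -oi g1H ?rE; [congr (H (_, _)); lra|exact: outerS].
exists g; split.
- have -> : @unit_cube I = A `|` B.
    apply/seteqP; split=> x.
      by move=> Cx; case: (lerP (radius x) 2^-1) => [|/ltW] rx; [left|right].
    by move=> [Ax|[]//]; apply/unit_cubeE; move: Ax; rewrite /A/=; lra.
  have cA : closed A by apply: closed_le_cts; [exact: radius_cts|exact: cts_on_cst].
  have cB : closed B.
    apply: closedI; first exact: closed_unit_cube.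
    by apply: closed_le_cts; [exact: cts_on_cst|exact: radius_cts].
  apply: cts_onU => //.
    apply: (@cts_on_eq _ _ _ (g1 \o inner)); first by move=> x Ax; rewrite /g Ax.
    apply: (cts_on_comp (B := @unit_cube I)) => //.
    apply: cts_on_prod => i; apply: cts_onB; last exact: cts_on_cst.
    by apply: cts_onM; [exact: cts_on_cst|exact: coord_cts].
  apply: cts_on_eq gB _.
  apply: (cts_on_comp (f := fun x => (outer x, 2 - 2 * radius x)) _ _ cH).
    apply: cts_on_pair.
      apply: cts_on_prod => i; apply: cts_onD; first exact: cts_on_cst.
      apply: cts_onM.
        apply: cts_onB; last exact: cts_on_cst.
        by apply: cts_onM; [exact: cts_on_cst|exact: coord_cts].
      apply: cts_onV.
        by move=> x [_ /= rx]; apply: lt0r_neq0; lra.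
      by apply: cts_onM; [exact: cts_on_cst|exact: radius_cts].
    apply: cts_onB; first exact: cts_on_cst.
    by apply: cts_onM; [exact: cts_on_cst|exact: radius_cts].
  move=> x Bx; split; first exact: outerS.
  by have [/unit_cubeE r1 /= r2] := Bx; rewrite /=; lra.
- move=> x Cx; rewrite /g; case: ifPn => [Ax|]; first exact/g1X/innerC.
  rewrite -ltNge => /ltW rx; apply: HX; first by apply: outerS.
  by have /unit_cubeE := Cx; lra.
- move=> x /[dup] Sx /unit_sphereE rx; rewrite /g rx ifF; last by apply/negbTE;
  rewrite -ltNge; lra.
  congr (H (_, _)); last by lra.
  by apply/funext => i; rewrite /outer rx; lra.
Qed.

End Cubes.

(** * Extension over a cubical grid *)

Section Subdivision.
Variable R : realType.
Local Notation E I := (prod_topology (fun _ : I => R)).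

Section Grid.
Variables (I : finType) (N : nat).
Hypothesis N_gt0 : (0 < N)%N.

(* Faces of the subdivision of the unit cube into N^#|I| cubes: an even code 2a
   is the coordinate a/N, an odd code 2a+1 is the interval [a/N, (a+1)/N]. *)
Definition face := {ffun I -> 'I_(N.*2.+1)}.
Implicit Types (F G : face) (x : E I).

Definition cell F : set (E I) :=
  [set x | forall i, ((F i)./2)%:R <= N%:R * x i <= (uphalf (F i))%:R].

Definition open_cell F : set (E I) :=
  [set x | cell F x /\
    forall i, odd (F i) -> ((F i)./2)%:R < N%:R * x i < (uphalf (F i))%:R].

Definition face_le F G : bool :=
  [forall i, ((G i)./2 <= (F i)./2)%N && (uphalf (F i) <= uphalf (G i))%N].

Definition face_dim F : nat := #|[set i | odd (F i)]%SET|.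

Definition boundary_faces : {set face} :=
  [set F : face | [exists i, (F i == 0%N :> nat) || (F i == N.*2 :> nat)]]%SET.

Lemma NR_gt0 : 0 < N%:R :> R. Proof. by rewrite ltr0n. Qed.

Lemma face_leP F G : reflect
  (forall i, ((G i)./2 <= (F i)./2)%N /\ (uphalf (F i) <= uphalf (G i))%N)
  (face_le F G).
Proof.
apply: (iffP forallP) => H i; first by apply/andP/H.
by have [-> ->] := H i.
Qed.

Lemma face_lexx F : face_le F F.
Proof. by apply/face_leP. Qed.

Lemma face_le_trans G F H : face_le F G -> face_le G H -> face_le F H.
Proof.
move=> /face_leP FG /face_leP GH; apply/face_leP => i.
have [a b] := FG i; have [c e] := GH i.
by split; [exact: leq_trans a|exact: leq_trans e].
Qed.

Lemma cellS F G : face_le F G -> cell F `<=` cell G.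
Proof.
move=> /face_leP FG x Fx i; have [a b] := FG i.
have /andP[c e] := Fx i; apply/andP; split.
  by apply: le_trans c; rewrite ler_nat.
by apply: le_trans e _; rewrite ler_nat.
Qed.

Lemma open_cell_le F G x : open_cell F x -> cell G x -> face_le F G.
Proof.
move=> [Fx oFx] Gx; apply/face_leP => i; have /andP[c e] := Gx i.
case: (boolP (odd (F i))) => oF.
  have /andP[c' e'] := oFx i oF.
  have := le_lt_trans c e'; have := lt_le_trans c' e.
  by rewrite !ltr_nat (uphalf_half (F i)) oF add1n ltnS => -> ->.
have /andP[c' e'] := Fx i.
have := le_trans c e'; have := le_trans c' e.
by rewrite !ler_nat (uphalf_half (F i)) (negbTE oF) add0n => -> ->.
Qed.

Lemma cube_open_cell x : unit_cube x -> exists F, open_cell F x.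
Proof.
move=> Cx.
have H i : exists c : 'I_(N.*2.+1), [/\ (c./2)%:R <= N%:R * x i <= (uphalf c)%:R &
    odd c -> (c./2)%:R < N%:R * x i < (uphalf c)%:R].
  have /andP[x0 x1] := Cx i.
  have Nx0 : 0 <= N%:R * x i by rewrite mulr_ge0.
  have NxN : N%:R * x i <= N%:R by rewrite ler_piMr.
  have /andP[t1 t2] := truncn_itv Nx0; set a := Num.trunc _ in t1 t2.
  case: (eqVneq a%:R (N%:R * x i)) => [aE|aN].
    have aN : (a.*2 < N.*2.+1)%N by rewrite ltnS leq_double -(ler_nat R) aE.
    exists (Ordinal aN); rewrite /= odd_double doubleK uphalf_double aE lexx.
    by split.
  have lt1 : a%:R < N%:R * x i by rewrite lt_neqAle aN.
  have aN' : (a.*2.+1 < N.*2.+1)%N.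
    by rewrite ltnS ltn_double -(ltr_nat R); apply: lt_le_trans NxN.
  exists (Ordinal aN'); rewrite /= !uphalf_double odd_double doubleK lt1 t2.
  by split=> //; rewrite (ltW lt1) (ltW t2).
have [F HF] := choice H.
exists [ffun i => F i]; split=> i; rewrite !ffunE; first by have [] := HF i.
by move=> oF; have [_] := HF i; apply.
Qed.

Lemma face_dim_lt F G : face_le F G -> F != G -> (face_dim F < face_dim G)%N.
Proof.
move=> /face_leP FG FneG; apply: proper_card.
have sub i : odd (F i) -> F i = G i.
  move=> oF; apply/val_inj => /=; have [a b] := FG i.
  rewrite -(odd_double_half (F i)) -(odd_double_half (G i)) oF.
  move: a b; rewrite !uphalf_half oF; case: (odd (G i)).
    by rewrite !add1n ltnS => a b; congr (_.*2.+1); apply/eqP; rewrite eqn_leq a b.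
  by rewrite add0n add1n => a b; move: (leq_trans b a); rewrite ltnn.
apply/properP; split.
  by apply/fintype.subsetP => i; rewrite !inE => oF; rewrite -sub.
suff /existsP[i /andP[oG oF]] : [exists i, odd (G i) && ~~ odd (F i)].
  by exists i; rewrite inE.
apply: contraNT FneG => /existsPn H; apply/eqP/ffunP => i.
case: (boolP (odd (F i))) => [/sub//|oF].
have := H i; rewrite negb_and negbK (negbTE oF) orbF => oG.
apply/val_inj => /=; have [a b] := FG i.
rewrite -(odd_double_half (F i)) -(odd_double_half (G i)) (negbTE oF) (negbTE oG).
move: a b; rewrite !uphalf_half (negbTE oF) (negbTE oG) !add0n => a b.
by congr (_.*2); apply/eqP; rewrite eqn_leq a b.
Qed.

Lemma cell_cube F : cell F `<=` @unit_cube R I.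
Proof.
move=> x Fx i; have /andP[a b] := Fx i; have := NR_gt0 => N0.
have uN : (uphalf (F i) <= N)%N.
  by rewrite leq_uphalf_double -ltnS.
apply/andP; split.
  by rewrite -(pmulr_rge0 _ N0); apply: le_trans a.
by rewrite -(ler_pM2l N0) mulr1; apply: le_trans b _; rewrite ler_nat.
Qed.

Lemma unit_sphere_cells x :
  unit_sphere x <-> exists2 F, F \in boundary_faces & cell F x.
Proof.
have N0 := NR_gt0; split=> [[Cx [i xi]]|[F]].
  have [F oF] := cube_open_cell Cx; exists F; last by case: oF.
  have [Fx oFx] := oF; rewrite inE; apply/existsP; exists i.
  have uN : (uphalf (F i) <= N)%N by rewrite leq_uphalf_double -ltnS.
  case: (boolP (odd (F i))) => [odF|eF].
    have /andP[a b] := oFx i odF; case: xi => xi; rewrite xi ?mulr0 ?mulr1 in a b.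
      by move: a; rewrite ltNge ler0n.
    by move: b; rewrite ltr_nat ltnNge uN.
  have /andP[a b] := Fx i.
  rewrite -(odd_double_half (F i)) (negbTE eF) add0n.
  move: a b; rewrite uphalf_half (negbTE eF) add0n.
  case: xi => ->; first by rewrite mulr0 lern0 => /eqP ->.
  rewrite mulr1 !ler_nat => a b; apply/orP; right.
  by rewrite (eqP (_ : (F i)./2 == N)) // eqn_leq a b.
rewrite inE => /existsP[i Fi] Fx; split; first exact: cell_cube Fx.
exists i; have /andP[a b] := Fx i; case/orP: Fi => /eqP Fi; rewrite Fi in a b.
  left; apply: (mulfI (lt0r_neq0 N0)).
  by rewrite mulr0; apply/le_anti; rewrite a b.
right; rewrite doubleK uphalf_double in a b; apply: (mulfI (lt0r_neq0 N0)).
by rewrite mulr1; apply/le_anti; rewrite a b.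
Qed.

Lemma closed_cell F : closed (cell F).
Proof.
have -> : cell F = \bigcap_i ([set x | ((F i)./2)%:R <= N%:R * x i] `&`
                             [set x | N%:R * x i <= (uphalf (F i))%:R]).
  apply/seteqP; split=> x H i => [_|]; first by have /andP[] := H i.
  by have [a b] := H i Logic.I; apply/andP.
apply: closed_bigI => i _; apply: closedI; apply: closed_le_cts;
  try exact: cts_on_cst; by apply: cts_onM; [exact: cts_on_cst|exact: coord_cts].
Qed.

Lemma cell_extension (U : topologicalType) (X : set U) F (f : E I -> U) :
  spheres_extendable R (face_dim F) X ->
  cts_on (cell F `\` open_cell F) f ->
  (forall x, (cell F `\` open_cell F) x -> X (f x)) ->
  exists g : E I -> U, [/\ cts_on (cell F) g, forall x, cell F x -> X (g x) &
    forall x, (cell F `\` open_cell F) x -> g x = f x].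
Proof.
move=> extX cf fX; have N0 := NR_gt0; have Nn0 := lt0r_neq0 N0.
pose J : finType := {i : I | odd (F i)}.
pose h i : R := ((F i)./2)%:R.
pose emb (y : E J) : E I := fun i => N%:R^-1 * (h i + oapp y 0 (insub i)).
pose prj (x : E I) : E J := fun j => N%:R * x (val j) - h (val j).
have Nemb y i : N%:R * emb y i = h i + oapp y 0 (insub i) by rewrite mulVKf.
have uphE i : odd (F i) -> (uphalf (F i))%:R = h i + 1.
  by move=> oF; rewrite uphalf_half oF add1n -natr1.
have embC y : unit_cube y -> cell F (emb y).
  move=> Cy i; rewrite Nemb; case: insubP => [j oF jE|/negbTE eF] /=.
    by rewrite uphE//; have := Cy j; rewrite /h; lra.
  by rewrite uphalf_half eF add0n /h addr0 !lexx.
have embS y : unit_sphere y -> (cell F `\` open_cell F) (emb y).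
  move=> [Cy [j yj]]; split; first exact: embC.
  move=> [_ /(_ (val j) (valP j))]; rewrite Nemb valK /= uphE ?(valP j)//.
  by case: yj => ->; rewrite /h; lra.
have prjC x : cell F x -> unit_cube (prj x).
  by move=> Fx j; have := Fx (val j); rewrite uphE ?(valP j)// /prj /h; lra.
have prjK x : cell F x -> emb (prj x) = x.
  move=> Fx; apply/funext => i; apply: (mulfI Nn0); rewrite Nemb.
  case: insubP => [j oF <-|/negbTE eF] /=; first by rewrite /prj; lra.
  by have := Fx i; rewrite uphalf_half eF add0n addr0 => /le_anti.
have prjS x : (cell F `\` open_cell F) x -> unit_sphere (prj x).
  move=> [Fx oFx]; split; first exact: prjC.
  apply: contrapT => /forallNP H; apply: oFx; split=> // i oF.
  have /not_orP[] := H (Sub i oF); rewrite /prj SubK uphE// => /eqP a /eqP b.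
  have := Fx i; rewrite uphE// -/(h i) => /andP[c e].
  rewrite !lt_neqAle c e !andbT; move: a b; rewrite subr_eq0 eq_sym => -> /=.
  by rewrite subr_eq addrC.
have prj_cts A : cts_on A prj.
  apply: cts_on_prod => j; apply: cts_onB; last exact: cts_on_cst.
  by apply: cts_onM; [exact: cts_on_cst|exact: coord_cts].
have emb_cts A : cts_on A emb.
  apply: cts_on_prod => i; apply: cts_onM; first exact: cts_on_cst.
  apply: cts_onD; first exact: cts_on_cst.
  by case: insubP => [j _ _|_] /=; [exact: coord_cts|exact: cts_on_cst].
have [|||g [cg gX gf]] := extX J _ (f \o emb).
- by rewrite card_sig /face_dim cardsE.
- exact: cts_on_comp (emb_cts _) embS cf.
- by move=> y Sy; apply: fX; exact: embS.
exists (g \o prj); split.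
- exact: cts_on_comp (prj_cts _) prjC cg.
- by move=> x Fx; apply: gX; exact: prjC.
- by move=> x Fx; rewrite /= gf; [rewrite /= prjK//; case: Fx|exact: prjS].
Qed.

Definition down_closed (Y : {set face}) : Prop :=
  forall F G, G \in Y -> face_le F G -> F \in Y.

Definition cells (Y : {set face}) : set (E I) :=
  [set x | exists2 F, F \in Y & cell F x].

Lemma down_closed_boundary : down_closed boundary_faces.
Proof.
move=> F G; rewrite !inE => /existsP[i Gi] /face_leP/(_ i) [a b].
apply/existsP; exists i; have FN : (F i <= N.*2)%N by rewrite -ltnS.
case/orP: Gi => /eqP Gi; rewrite Gi ?doubleK ?uphalf_double in a b.
  by move: b; rewrite leqn0; case: (nat_of_ord (F i)).
apply/orP; right; rewrite eqn_leq FN /=.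
by apply: leq_trans (_ : (F i)./2.*2 <= _)%N;
  rewrite ?leq_double// -{2}(odd_double_half (F i)) leq_addl.
Qed.

(* Cells are filled one at a time in order of dimension. *)
Lemma carrier_extension (U : topologicalType) (Phi : face -> set U) (f : E I -> U) :
  (forall F G, face_le F G -> Phi F `<=` Phi G) ->
  (forall F, spheres_extendable R (face_dim F) (Phi F)) ->
  cts_on (@unit_sphere R I) f ->
  (forall F x, F \in boundary_faces -> cell F x -> Phi F (f x)) ->
  exists g : E I -> U, [/\ cts_on (@unit_cube R I) g,
    forall x, unit_sphere x -> g x = f x & forall F x, cell F x -> Phi F (g x)].
Proof.
move=> Phi_mono Phi_ext cf fPhi.
have cells0 : cells boundary_faces = @unit_sphere R I.
  by apply/seteqP; split=> x /unit_sphere_cells.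
suff H m : forall Y : {set face}, #|Y :\: boundary_faces| = m ->
    boundary_faces \subset Y -> down_closed Y ->
    closed (cells Y) /\ exists g : E I -> U, [/\ cts_on (cells Y) g,
      forall x, unit_sphere x -> g x = f x &
      forall F x, F \in Y -> cell F x -> Phi F (g x)].
  have [||_ [g [cg gf gPhi]]] := H _ [set: face]%SET erefl.
  - exact: finset.subsetT.
  - by move=> F G _ _; rewrite inE.
  exists g; split=> // [|F x Fx]; last by apply: gPhi => //; rewrite inE.
  apply: cts_onW cg => x /cube_open_cell[F [Fx _]]; by exists F.
elim: m => [|m IH] Y Ym bY dY.
  have -> : Y = boundary_faces.
    by apply/eqP; rewrite finset.eqEsubset bY andbT -finset.setD_eq0 -cards_eq0 Ym.
  by rewrite cells0; split; [exact: closed_unit_sphere|exists f].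
have [F0 F0Y] : exists F, F \in Y :\: boundary_faces.
  by apply/set0Pn; rewrite -cards_eq0 Ym.
have [F Fin Fmax] := arg_maxnP face_dim F0Y.
have FY : F \in Y :\: boundary_faces by [].
have /finset.setDP[FinY FnB] := FY.
have Fmaximal G : G \in Y -> face_le F G -> G = F.
  move=> GY FG; apply/eqP; apply: contraT => GF.
  have GB : G \in Y :\: boundary_faces.
    by rewrite inE GY andbT; apply: contra FnB => /down_closed_boundary; apply.
  by have := Fmax G GB; rewrite /geq/= leqNgt face_dim_lt// eq_sym.
pose Y' := Y :\ F.
have Y'm : #|Y' :\: boundary_faces| = m.
  have := cardsD1 F (Y :\: boundary_faces); rewrite Ym FY add1n => -[->].
  by congr #|pred_of_set _|; apply/setP => G; rewrite !inE andbCA.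
have bY' : boundary_faces \subset Y' by rewrite finset.subsetD1 bY.
have dY' : down_closed Y'.
  move=> H G; rewrite !inE => /andP[GF GY] HG; rewrite (dY _ _ GY HG) andbT.
  by apply: contraNneq GF => HF; rewrite HF in HG; rewrite (Fmaximal G).
have [cY' [g' [cg' g'f g'Phi]]] := IH Y' Y'm bY' dY'.
have bdF x : (cell F `\` open_cell F) x ->
    exists G, [/\ G \in Y', face_le G F & cell G x].
  move=> [Fx oFx]; have [G oG] := cube_open_cell (cell_cube Fx).
  have GF := open_cell_le oG Fx; exists G; split=> //; last by case: oG.
  by rewrite !inE (dY _ _ FinY GF) andbT; apply: contra_notN oFx => /eqP <-.
have [||gF [cgF gFPhi gFg']] := cell_extension (Phi_ext F) (f := g').
- by apply: cts_onW cg' => x /bdF[G [GY' _ Gx]]; exists G.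
- by move=> x /bdF[G [GY' GF Gx]]; apply: (Phi_mono _ _ GF); exact: g'Phi.
have cellsE : cells Y = cells Y' `|` cell F.
  apply/seteqP; split=> x.
    move=> [G GY Gx]; have [GF|GF] := eqVneq G F; first by right; rewrite -GF.
    by left; exists G => //; rewrite !inE GF.
  move=> [[G]|Fx]; last by exists F.
  by rewrite !inE => /andP[_ GY] Gx; exists G.
pose g x := if `[< cell F x >] then gF x else g' x.
have gE' x : cells Y' x -> g' x = g x.
  move=> [G GY' Gx]; rewrite /g; case: asboolP => // Fx.
  rewrite gFg'//; split=> // oFx; have FG := open_cell_le oFx Gx.
  by move: GY'; rewrite !inE => /andP[+ GY]; rewrite (Fmaximal G)// eqxx.
have gEF x : cell F x -> gF x = g x by move=> Fx; rewrite /g asboolT.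
rewrite cellsE; split; first by apply: closedU => //; exact: closed_cell.
exists g; split.
- by apply: cts_onU => //;
  [exact: closed_cell|exact: cts_on_eq cg'|exact: cts_on_eq cgF].
- move=> x Sx; rewrite -gE' ?g'f//; move: Sx; rewrite -cells0 => -[G GB Gx].
  by exists G => //; exact: (fintype.subsetP bY').
- move=> G x GY Gx; have [GF|GF] := eqVneq G F.
    by rewrite GF in Gx *; rewrite -gEF//; exact: gFPhi.
  have GY' : G \in Y' by rewrite !inE GF.
  by rewrite -gE'; [exact: g'Phi|exists G].
Qed.

End Grid.

End Subdivision.

(** * Realisations of simplicial complexes *)

Section Complexes.
Variable R : realType.
Local Notation E I := (prod_topology (fun _ : I => R)).

Section Realisation.
Variable V : finType.
Implicit Types (K L : {set {set V}}) (s : {set V}) (t u : E V).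

Definition realisation K : set (E V) :=
  [set t | [/\ forall v, 0 <= t v, \sum_v t v = 1 & [set v | t v != 0]%SET \in K]].

Definition face_closed K : Prop :=
  forall s1 s2, s1 \in K -> s2 != finset.set0 -> s2 \subset s1 -> s2 \in K.

Definition in_simplex s t : Prop :=
  [/\ forall v, 0 <= t v, \sum_v t v = 1 & forall v, v \notin s -> t v = 0].

Lemma realisationP K t : face_closed K ->
  realisation K t <-> exists2 s, s \in K & in_simplex s t.
Proof.
move=> Kf; split=> [[t0 t1 tK]|[s sK [t0 t1 ts]]].
  exists [set v | t v != 0]%SET => //; split=> // v.
  by rewrite inE negbK => /eqP.
split=> //; apply: (Kf s) => //.
  apply/negP => /eqP/setP tn; move: t1; rewrite big1 => [/esym/eqP|v _].
    by rewrite oner_eq0.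
  by have := tn v; rewrite !inE => /negbFE/eqP.
by apply/fintype.subsetP => v; rewrite inE; apply: contraNT => /ts ->.
Qed.

Lemma realisationI K L : realisation (K :&: L) = realisation K `&` realisation L.
Proof.
apply/seteqP; split=> t; first by move=> [t0 t1 /setIP[tK tL]]; split; split.
by move=> [[t0 t1 tK] [_ _ tL]]; split=> //; rewrite inE tK.
Qed.

Lemma realisationU K L : realisation (K :|: L) = realisation K `|` realisation L.
Proof.
apply/seteqP; split=> t.
  by move=> [t0 t1 /setUP[tK|tL]]; [left|right].
by move=> [[t0 t1 tK]|[t0 t1 tL]]; split=> //; rewrite inE ?tK ?tL ?orbT.
Qed.

Definition vertex_point (v : V) : E V := fun w => (w == v)%:R.

Lemma vertex_in_simplex s v : v \in s -> in_simplex s (vertex_point v).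
Proof.
move=> vs; split=> [w||w ws]; first by rewrite /vertex_point ler0n.
  rewrite (bigD1 v) //= /vertex_point eqxx big1 ?addr0// => w /negbTE -> //.
by rewrite /vertex_point (negbTE (_ : w != v))//; apply: contraNneq ws => ->.
Qed.

Lemma segment_in_simplex s t u (a : R) : in_simplex s t -> in_simplex s u ->
  0 <= a <= 1 -> in_simplex s (fun v => (1 - a) * t v + a * u v).
Proof.
move=> [t0 t1 ts] [u0 u1 us] /andP[a0 a1]; split=> [v||v vs].
- by rewrite addr_ge0 ?mulr_ge0// subr_ge0.
- by rewrite big_split/= -!mulr_sumr t1 u1 !mulr1 subrK.
- by rewrite ts// us// !mulr0 addr0.
Qed.

Lemma straight_line_extension (I : finType) K (f0 f1 g1 : E I -> E V) :
  face_closed K ->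
  cts_on (@unit_sphere R I) f0 -> cts_on (@unit_sphere R I) f1 ->
  (forall x, unit_sphere x ->
    exists s, [/\ s \in K, in_simplex s (f0 x) & in_simplex s (f1 x)]) ->
  cts_on (@unit_cube R I) g1 -> (forall x, unit_cube x -> realisation K (g1 x)) ->
  (forall x, unit_sphere x -> g1 x = f1 x) ->
  exists g : E I -> E V, [/\ cts_on (@unit_cube R I) g,
    forall x, unit_cube x -> realisation K (g x) &
    forall x, unit_sphere x -> g x = f0 x].
Proof.
move=> Kf cf0 cf1 f01 cg1 g1K g1f1.
pose H (xa : E I * R) : E V := fun v => (1 - xa.2) * f0 xa.1 v + xa.2 * f1 xa.1 v.
have [|x a Sx a01|x Sx|g [cg gK gH]] := homotopy_extension (H := H) _ _ cg1 g1K.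
- have cfst A : cts_on (A : set (E I * R)) fst.
    by apply: continuous_cts_on => x; apply: cvg_fst.
  have csnd A : cts_on (A : set (E I * R)) snd.
    by apply: continuous_cts_on => x; apply: cvg_snd.
  apply: cts_on_prod => v; apply: cts_onD; apply: cts_onM => //.
  + by apply: cts_onB => //; exact: cts_on_cst.
  + apply: (cts_on_comp (f := fst) (g := fun x => f0 x v) (cfst _));
    last exact: cts_on_proj cf0.
    by move=> x [].
  + apply: (cts_on_comp (f := fst) (g := fun x => f1 x v) (cfst _));
    last exact: cts_on_proj cf1.
    by move=> x [].
- have [s [sK f0s f1s]] := f01 x Sx.
  by apply/realisationP => //; exists s => //; exact: segment_in_simplex.
- by rewrite g1f1//; apply/funext => v; rewrite /H/= subrr mul0r add0r mul1r.
- exists g; split=> // x Sx; rewrite gH//; apply/funext => v.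
  by rewrite /H/= subr0 mul0r addr0 mul1r.
Qed.

Lemma cone_extendable (v : V) K d : face_closed K -> [set v]%SET \in K ->
  (forall s, s \in K -> v |: s \in K) -> spheres_extendable R d (realisation K).
Proof.
move=> Kf vK Kv I _ f cf fK.
apply: (@straight_line_extension I K f (fun _ => vertex_point v) (fun _ =>
  vertex_point v)) => //.
- exact: cts_on_cst.
- move=> x Sx; have /realisationP[//|s sK [t0 t1 ts]] := fK x Sx.
  exists (v |: s); split; [exact: Kv| |by apply: vertex_in_simplex;
    rewrite !inE eqxx].
  by split=> // w; rewrite !inE negb_or => /andP[_]; exact: ts.
- exact: cts_on_cst.
- move=> x _; apply/realisationP => //; exists [set v]%SET => //.
  by apply: vertex_in_simplex; rewrite inE.
Qed.

(* Maps a neighbourhood of each closed simplex into that simplex. *)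
Definition shrink (e : R) t : E V :=
  fun v => Num.max (t v - e) 0 / \sum_w Num.max (t w - e) 0.

Lemma shrink_sum_gt0 (e : R) t : e * #|V|%:R < 1 -> \sum_v t v = 1 ->
  0 < \sum_w Num.max (t w - e) 0.
Proof.
move=> eV t1; apply: (@lt_le_trans _ _ (\sum_w (t w - e))).
  by rewrite sumrB t1 sumr_const subr_gt0 -mulr_natr.
by apply: ler_sum => w _; rewrite le_max lexx.
Qed.

Lemma shrink_in_simplex (e : R) s t : e * #|V|%:R < 1 ->
  \sum_v t v = 1 -> (forall v, v \notin s -> t v <= e) -> in_simplex s (shrink e t).
Proof.
move=> eV t1 ts; have S0 := shrink_sum_gt0 eV t1; split=> [v||v vs].
- by rewrite divr_ge0 ?(ltW S0)// le_max lexx orbT.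
- by rewrite -mulr_suml divff// gt_eqF.
- by rewrite /shrink max_r ?mul0r// subr_le0 ts.
Qed.

Lemma shrink_cts (e : R) (T : topologicalType) (A : set T) (f : T -> E V) :
  e * #|V|%:R < 1 -> cts_on A f -> (forall x, A x -> \sum_v f x v = 1) ->
  cts_on A (shrink e \o f).
Proof.
move=> eV cf f1.
have c v : cts_on A (fun x => Num.max (f x v - e) 0).
  apply: cts_on_max; last exact: cts_on_cst.
  by apply: cts_onB; [exact: cts_on_proj cf|exact: cts_on_cst].
apply: cts_on_prod => v; apply: cts_onM => //; apply: cts_onV.
  by move=> x Ax; rewrite gt_eqF// shrink_sum_gt0// f1.
exact: cts_on_sum.
Qed.

Lemma cell_dist (I : finType) (N : nat) (F : face I N) (x y : E I) :
  (0 < N)%N -> cell F x -> cell F y -> forall i, `|x i - y i| <= N%:R^-1.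
Proof.
move=> N0 Fx Fy i; have N0R : 0 < N%:R :> R by rewrite ltr0n.
rewrite -(ler_pM2l N0R) divff ?gt_eqF// -{1}(gtr0_norm N0R) -normrM mulrBr.
have := Fx i; have := Fy i; rewrite uphalf_half natrD.
have : (odd (F i))%:R <= 1 :> R by case: odd.
by rewrite ler_norml; lra.
Qed.

Lemma glue_extendable d K L : face_closed K -> face_closed L ->
  spheres_extendable R d.+1 (realisation K) ->
  spheres_extendable R d.+1 (realisation L) ->
  spheres_extendable R d (realisation (K :&: L)) ->
  spheres_extendable R d.+1 (realisation (K :|: L)).
Proof.
move=> Kf Lf extK extL extKL I Id f cf fKL.
have KLf : face_closed (K :|: L).
  by move=> s1 s2 /setUP[] sK s0 s12; apply/setUP; [left;
    apply: Kf sK _ _|right; apply: Lf sK _ _].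
pose e : R := (#|V|.+1)%:R^-1.
have e0 : 0 < e by rewrite invr_gt0 ltr0n.
have eV : e * #|V|%:R < 1 by rewrite /e mulrC ltr_pdivrMr ?ltr0n// mul1r ltr_nat.
have [dl dl0 Hdl] := uniformly_cts_sphere e0 cf.
have [N N0 Ndl] : exists2 N, (0 < N)%N & N%:R^-1 < dl.
  exists (Num.trunc dl^-1).+1 => //.
  by rewrite invf_plt ?posrE ?ltr0n//; exact: truncnS_gt.
pose f1 := shrink e \o f.
have f1c : cts_on (@unit_sphere R I) f1.
  by apply: shrink_cts => // x /fKL[].
pose A (Q : face I N) := forall x, cell Q x -> unit_sphere x -> realisation K
  (f1 x).
pose lab Q := if `[< A Q >] then realisation K else realisation L.
have labP Q x : cell Q x -> unit_sphere x -> lab Q (f1 x).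
  move=> Qx Sx; rewrite /lab; case: asboolP => [|]; first by apply.
  move=> /existsNP[y /not_implyP[Qy /not_implyP[Sy nKy]]].
  have near z : cell Q z -> unit_sphere z -> in_simplex [set v | f y v !=
    0]%SET (f1 z).
    move=> Qz Sz; apply: shrink_in_simplex => //; first by have [] := fKL z Sz.
    move=> v; rewrite inE negbK => /eqP fyv; apply: ltW.
    apply: le_lt_trans (ler_norm _) _; rewrite -[f z v]subr0 -fyv.
    by apply: Hdl => // i; apply: le_lt_trans Ndl; exact: cell_dist Qz Qy _.
  have [_ _ /setUP[yK|yL]] := fKL y Sy.
    by case: nKy; apply/realisationP => //; eexists; [exact: yK|exact: near].
  by apply/realisationP => //; eexists; [exact: yL|exact: near].
pose Phi F := [set t | forall Q, face_le F Q -> lab Q t].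
have [||||g1 [cg1 g1f1 g1Phi]] := @carrier_extension R I N N0 _ Phi f1.
- by move=> F G FG t Ft Q GQ; apply: Ft; exact: face_le_trans GQ.
- move=> F.
  have dimI (Q : face I N) : (face_dim Q <= #|I|)%N by exact: max_card.
  case: (pselect (forall Q, face_le F Q -> A Q)) => [allA|/existsNP[Q2
    /not_implyP[FQ2 nA2]]].
    have -> : Phi F = realisation K.
      apply/seteqP; split=> t; first by move=> /(_ F (face_lexx F));
        rewrite /lab asboolT//; exact/allA/face_lexx.
      by move=> Kt Q /allA AQ; rewrite /lab asboolT.
    by apply: spheres_extendableW extK; apply: leq_trans (dimI F) Id.
  case: (pselect (forall Q, face_le F Q -> ~ A Q)) => [allN|/existsNP[Q1
    /not_implyP[FQ1 /contrapT A1]]].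
    have -> : Phi F = realisation L.
      apply/seteqP; split=> t; first by move=> /(_ F (face_lexx F));
        rewrite /lab asboolF//; exact/allN/face_lexx.
      by move=> Lt Q /allN AQ; rewrite /lab asboolF.
    by apply: spheres_extendableW extL; apply: leq_trans (dimI F) Id.
  have -> : Phi F = realisation (K :&: L).
    rewrite realisationI; apply/seteqP; split=> t.
      move=> Ft; split; first by have := Ft Q1 FQ1; rewrite /lab asboolT.
      by have := Ft Q2 FQ2; rewrite /lab asboolF.
    by move=> [Kt Lt] Q _; rewrite /lab; case: ifP.
  apply: spheres_extendableW extKL; rewrite -ltnS.
  have [FE|FN] := eqVneq F Q1.
    have FN2 : F != Q2 by apply: contra_notN nA2 => /eqP <-; rewrite FE.
    by apply: leq_trans (leq_trans (face_dim_lt FQ2 FN2) (dimI Q2)) Id.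
  by apply: leq_trans (leq_trans (face_dim_lt FQ1 FN) (dimI Q1)) Id.
- exact: f1c.
- move=> F x FB Fx Q FQ; apply: labP; first exact: cellS FQ _ Fx.
  by apply/(unit_sphere_cells N0); exists F.
apply: (straight_line_extension KLf cf f1c _ cg1) => //.
  move=> x Sx; have [t0 t1 tKL] := fKL x Sx; eexists; split; first exact: tKL.
    by split=> // v; rewrite inE negbK => /eqP.
  by apply: shrink_in_simplex => // v; rewrite inE negbK => /eqP ->; exact: ltW.
move=> x /(cube_open_cell N)[F [Fx _]]; rewrite realisationU.
have := g1Phi F x Fx F (face_lexx F); rewrite /lab; by case: ifP => _ H;
  [left|right].
Qed.

End Realisation.

End Complexes.

(** * Clique complexes *)

Section Connectivity.
Variable R : realType.
Local Notation E I := (prod_topology (fun _ : I => R)).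

Section Nerve.
Variable V : finType.

Lemma face_closedI (K L : {set {set V}}) :
  face_closed K -> face_closed L -> face_closed (K :&: L).
Proof.
move=> Kf Lf s1 s2 /setIP[sK sL] s0 s12.
by rewrite inE (Kf _ _ sK)// (Lf _ _ sL).
Qed.

Lemma face_closed_bigcup (J : finType) (D : {set J}) (L : J -> {set {set V}}) :
  (forall j, face_closed (L j)) -> face_closed (\bigcup_(j in D) L j)%SET.
Proof.
move=> Lf s1 s2 /finset.bigcupP[j jD sL] s0 s12; apply/finset.bigcupP;
  exists j => //.
exact: Lf sL _ _.
Qed.

Lemma spheres_extendable0S (U : topologicalType) (X Y : set U) :
  X `<=` Y -> spheres_extendable R 0 X -> spheres_extendable R 0 Y.
Proof.
move=> XY extX I I0 f cf fY.
have noS (x : E I) : ~ unit_sphere x.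
  move=> [_ [i _]]; have := max_card (pred1 i).
  by rewrite card1 => /leq_trans/(_ I0).
have [|g [cg gX gf]] := extX I I0 f cf; first by move=> x /noS.
by exists g; split=> // x Cx; apply: XY; exact: gX.
Qed.

Lemma nerve_extendable (J : finType) (L : J -> {set {set V}}) (D : {set J}) d :
  D != finset.set0 -> (forall j, face_closed (L j)) ->
  (forall T : {set J}, T \subset D -> T != finset.set0 -> (#|T| <= d.+1)%N ->
    spheres_extendable R (d.+1 - #|T|) (@realisation R _ (\bigcap_(j in T) L
      j)%SET)) ->
  spheres_extendable R d (@realisation R _ (\bigcup_(j in D) L j)%SET).
Proof.
have [m] := ubnP #|D|; elim: m => // m IH in L D d * => /ltnSE Dm D0 Lf H.
have /set0Pn[j0 j0D] := D0.
have H1 j : j \in D -> spheres_extendable R d (@realisation R _ (L j)).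
  move=> jD; have := H [set j]%SET;
    rewrite finset.big_set1 finset.cards1 subn1; apply.
  - by rewrite finset.sub1set.
  - by apply/set0Pn; exists j; rewrite inE.
  - by [].
pose D' := D :\ j0.
have D'm : (#|D'| < m)%N.
  by apply: leq_trans Dm; rewrite (cardsD1 j0 D) j0D add1n.
have -> : (\bigcup_(j in D) L j = L j0 :|: \bigcup_(j in D') L j)%SET.
  by rewrite (big_setD1 j0).
have [D'0|D'0] := eqVneq D' finset.set0.
  by rewrite D'0 big_set0 finset.setU0; exact: H1.
have sub (T : {set J}) : T \subset D' -> T \subset D.
  by move=> TD'; apply: fintype.subset_trans TD' (finset.subD1set _ _).
case: d => [|d] in H H1 *.
  apply: spheres_extendable0S (H1 _ j0D).
  by rewrite realisationU; exact: subsetUl.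
apply: glue_extendable; [exact: Lf|exact: face_closed_bigcup|exact: H1| |].
  by apply: IH => // T /sub; exact: H.
have -> : (L j0 :&: \bigcup_(j in D') L j = \bigcup_(j in D') (L j0 :&: L j))%SET.
  by rewrite big_distrr.
apply: IH => // [j|T TD' T0 Td]; first exact: face_closedI.
have j0T : j0 \notin T.
  by apply/negP => /(fintype.subsetP TD'); rewrite !inE eqxx.
have -> : (\bigcap_(j in T) (L j0 :&: L j) = \bigcap_(j in j0 |: T) L j)%SET.
  apply/setP => s; apply/finset.bigcapP/finset.bigcapP => Hs j.
    rewrite !inE => /predU1P[->|jT]; last by have := Hs j jT;
      rewrite inE => /andP[].
    by have /set0Pn[k kT] := T0; have := Hs k kT; rewrite inE => /andP[].
  by move=> jT; rewrite inE !Hs// !inE ?eqxx// jT orbT.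
have := H (j0 |: T); rewrite cardsU1 j0T add1n subSS; apply.
- by rewrite finset.subUset finset.sub1set j0D sub.
- by apply/set0Pn; exists j0; rewrite !inE eqxx.
- by rewrite ltnS.
Qed.

End Nerve.

Section FlagComplex.
Variables (V : finType) (adj : rel V).
Hypotheses (adjxx : reflexive adj) (adj_sym : symmetric adj).
Implicit Types (W S T s : {set V}).

Definition cliques W : {set {set V}} :=
  [set s : {set V} | [&& s != finset.set0, s \subset W &
    [forall x in s, [forall y in s, adj x y]]]]%SET.

Lemma cliquesP W s : reflect
  [/\ s != finset.set0, s \subset W & {in s &, forall x y, adj x y}]
  (s \in cliques W).
Proof.
rewrite inE; apply: (iffP and3P) => -[s0 sW sadj]; split=> //.
  by move=> x y xs ys; move/forall_inP: sadj => /(_ x xs)/forall_inP; apply.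
by apply/forall_inP => x xs; apply/forall_inP => y ys; exact: sadj.
Qed.

Lemma face_closed_cliques W : face_closed (cliques W).
Proof.
move=> s1 s2 /cliquesP[_ s1W s1adj] s20 s21; apply/cliquesP; split=> //.
  exact: fintype.subset_trans s21 s1W.
by move=> x y xs ys; apply: s1adj; exact: (fintype.subsetP s21).
Qed.

Definition common_neighbours W T : {set V} :=
  [set w in W | [forall v in T, adj v w]]%SET.

Lemma common_neighboursP W T w : reflect
  (w \in W /\ {in T, forall v, adj v w}) (w \in common_neighbours W T).
Proof.
rewrite inE; apply: (iffP andP) => -[wW wT]; split=> //; last exact/forall_inP.
by move=> v vT; move/forall_inP: wT; apply.
Qed.

Lemma common_neighboursS W T : common_neighbours W T \subset W.
Proof. by apply/fintype.subsetP => w /common_neighboursP[]. Qed.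

Definition dominated W (m : nat) : Prop :=
  forall S, S \subset W -> (#|S| <= m)%N ->
    exists2 w, w \in W & {in S, forall x, adj x w}.

(* Cover the clique complex by the stars of its vertices: the intersection of
   the stars of T is the clique complex on the common neighbours of T. *)
Theorem cliques_extendable d W : dominated W d.*2 ->
  spheres_extendable R d (@realisation R _ (cliques W)).
Proof.
have [m] := ubnP d; elim: m => // m IH in d W * => /ltnSE dm domW.
pose L v := cliques (common_neighbours W [set v]%SET).
have -> : cliques W = (\bigcup_(v in W) L v)%SET.
  apply/setP => s; apply/cliquesP/finset.bigcupP.
    move=> [s0 sW sadj]; have /set0Pn[v vs] := s0.
    exists v; first exact: (fintype.subsetP sW).
    apply/cliquesP; split=> //; apply/fintype.subsetP => w ws.
    apply/common_neighboursP; split; first exact: (fintype.subsetP sW).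
    by move=> u /set1P ->; exact: sadj.
  move=> [v vW /cliquesP[s0 sW sadj]]; split=> //.
  exact: fintype.subset_trans sW (common_neighboursS _ _).
apply: nerve_extendable.
- have [||w wW _] := domW finset.set0; [exact: finset.sub0set|by rewrite cards0|].
  by apply/set0Pn; exists w.
- by move=> v; exact: face_closed_cliques.
move=> T TW T0 Td.
have -> : (\bigcap_(v in T) L v)%SET = cliques (common_neighbours W T).
  apply/setP => s; apply/finset.bigcapP/cliquesP => [Hs|[s0 sW sadj] v vT].
    have /set0Pn[v vT] := T0; have /cliquesP[s0 _ sadj] := Hs v vT; split=> //.
    apply/fintype.subsetP => w ws; apply/common_neighboursP.
    have Lw u : u \in T -> w \in common_neighbours W [set u]%SET.
      by move=> /Hs/cliquesP[_ /fintype.subsetP sW _]; exact: sW.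
    split; first by have /common_neighboursP[] := Lw v vT.
    by move=> u /Lw/common_neighboursP[_]; apply; rewrite inE.
  apply/cliquesP; split=> //; apply/fintype.subsetP => w ws.
  have /common_neighboursP[wW wT] := fintype.subsetP sW w ws.
  by apply/common_neighboursP; split=> // u /set1P ->; exact: wT.
have [T1|T2] := leqP #|T| 1.
  have /cards1P[v Tv] : #|T| == 1%N by rewrite eqn_leq T1 card_gt0.
  have vadj w : w \in common_neighbours W T -> adj v w.
    by rewrite Tv => /common_neighboursP[_]; apply; rewrite inE.
  have vN : v \in common_neighbours W T.
    apply/common_neighboursP; split.
      by apply: (fintype.subsetP TW); rewrite Tv inE.
    by rewrite Tv => u /set1P ->.
  apply: (@cone_extendable _ _ v); first exact: face_closed_cliques.
    apply/cliquesP; split; first by apply/set0Pn; exists v; rewrite inE.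
      by rewrite finset.sub1set.
    by move=> x y; rewrite !inE => /eqP -> /eqP ->.
  move=> s /cliquesP[s0 sN sadj]; apply/cliquesP; split.
  - by apply/set0Pn; exists v; rewrite !inE eqxx.
  - by rewrite finset.subUset finset.sub1set vN.
  - move=> x y; rewrite !inE => /predU1P[->|xs] /predU1P[->|ys] //.
    + by apply/vadj/(fintype.subsetP sN).
    + by rewrite adj_sym; apply/vadj/(fintype.subsetP sN).
    + exact: sadj.
apply: IH; first by lia.
move=> S SN Sd.
have SW : S \subset W by apply: fintype.subset_trans SN (common_neighboursS _ _).
have [||w wW wadj] := domW (S :|: T).
- by rewrite finset.subUset SW.
- by apply: leq_trans (leq_card_setU _ _) _; lia.
exists w.
  by apply/common_neighboursP; split=> // v vT; apply: wadj; rewrite inE vT orbT.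
by move=> x xS; apply: wadj; rewrite inE xS.
Qed.

End FlagComplex.

End Connectivity.

(** * Homotopy groups *)

Section Loops.
Variable R : realType.
Local Notation E I := (prod_topology (fun _ : I => R)).

Lemma cts_on_mx (T : topologicalType) (A : set T) (m n : nat)
    (f : T -> 'M[R]_(m, n)) :
  (forall i j, cts_on A (fun x => f x i j)) -> cts_on A f.
Proof.
move=> cf x Ax Q [P fP PQ].
have FA : Filter (within A (nbhs x)) by exact: within_filter.
suff : within A (nbhs x) [set y | forall i j, P i j (f y i j)].
  by apply: filterS => y; exact: PQ.
apply: (@filter_forall _ _ (fun i y => forall j, P i j (f y i j)) _ FA) => i.
apply: (@filter_forall _ _ (fun j y => P i j (f y i j)) _ FA) => j.
exact: cf (fP i j).
Qed.

Lemma cts_on_set_val (T U : topologicalType) (A : set T) (B : set U)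
    (f : T -> set_type B) :
  cts_on A (fun x => set_val (f x)) <-> cts_on A f.
Proof.
split=> cf x Ax.
  move=> Q [/= _ [[W oW <-] Wfx] WQ].
  have H := cf x Ax W (open_nbhs_nbhs (conj oW Wfx)).
  apply: (@filterS _ (within A (nbhs x)) _ _ _ _ H) => y; exact: WQ.
have := cts_on_comp (B := setT) (g := set_val) cf (fun _ _ => Logic.I).
apply=> //; apply: continuous_cts_on; exact: initial_continuous.
Qed.

Section LoopsInComplex.
Variables (V : finType) (K : simplicial_complex V) (i : nat).
Let X := set_type (geometric_realisation R K).

(* Two loops f, g together with the constant map x0 define a map on the sphere
   of the (i + 1)-cube, whose extra coordinate None is the homotopy parameter. *)
Lemma loops_homotopic (x0 : X) (f g : 'rV[R]_i -> X) :
  spheres_extendable R i.+1 (@realisation R _ K) ->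
  cube_loop x0 f -> cube_loop x0 g -> cube_loop_homotopic x0 f g.
Proof.
move=> extK [/cts_onP cf f0] [/cts_onP cg g0].
pose J : finType := option 'I_i.
pose row_part (y : E J) : 'rV[R]_i := \row_j y (Some j).
pose pack (p : 'rV[R]_i * R) : E J :=
  fun j => if j is Some j' then p.1 ord0 j' else p.2.
have packN t s : pack (t, s) None = s by [].
have row_pack t s : row_part (pack (t, s)) = t.
  by apply/rowP => j; rewrite mxE.
have row_cts A : cts_on A row_part.
  apply: cts_on_mx => k j; apply: cts_on_eq (coord_cts (i := Some j)) => y _.
  by rewrite mxE.
have row_cube y : unit_cube y -> Defs.cube (row_part y).
  by move=> Cy j; rewrite mxE; exact: Cy.
pose h (y : E J) : X :=
  if y None == 0 then f (row_part y) else if y None == 1 then g (row_part y)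
    else x0.
pose A0 : set (E J) := @unit_cube R J `&` [set y | y None <= 0].
pose A1 : set (E J) := @unit_cube R J `&` [set y | 1 <= y None].
pose B : set (E J) := @unit_cube R J `&` [set y | cube_boundary (row_part y)].
have A0E y : A0 y -> y None = 0.
  by move=> [/(_ None)/andP[y0 _] /= y0']; apply/le_anti; rewrite y0 y0'.
have A1E y : A1 y -> y None = 1.
  by move=> [/(_ None)/andP[_ y1] /= y1']; apply/le_anti; rewrite y1 y1'.
have hB y : B y -> x0 = h y.
  by move=> [_ By]; rewrite /h; case: ifP => [_|_]; [rewrite f0|case: ifP;
    rewrite ?g0].
have hA0 y : A0 y -> f (row_part y) = h y by move=> /A0E y0; rewrite /h y0 eqxx.
have hA1 y : A1 y -> g (row_part y) = h y.
  by move=> /A1E y1; rewrite /h y1 oner_eq0 eqxx.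
have SE : @unit_sphere R J = A0 `|` A1 `|` B.
  apply/seteqP; split=> y.
    move=> [Cy [[j|] yj]]; [right|left].
      by split=> //; split; [exact: row_cube|exists j; rewrite mxE].
    by case: yj => yj; [left|right]; split=> //=; rewrite yj.
  move=> [[Ay|Ay]|[Cy [_ [j]]]].
  - by have [Cy _] := Ay; split=> //; exists None; left; exact: A0E.
  - by have [Cy _] := Ay; split=> //; exists None; right; exact: A1E.
  - by rewrite mxE => yj; split=> //; exists (Some j).
have cA0 : closed A0.
  apply: closedI; first exact: closed_unit_cube.
  by apply: closed_le_cts; [exact: coord_cts|exact: cts_on_cst].
have cA1 : closed A1.
  apply: closedI; first exact: closed_unit_cube.
  by apply: closed_le_cts; [exact: cts_on_cst|exact: coord_cts].
have cB : closed B.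
  pose res (y : E J) : E 'I_i := fun j => y (Some j).
  have -> : B = @unit_cube R J `&` res @^-1` (@unit_sphere R 'I_i).
    apply/seteqP; split=> y [Cy [Cr [j yj]]]; split=> //; split.
    - by move=> k; exact: Cy.
    - by exists j; move: yj; rewrite mxE.
    - exact: row_cube.
    - by exists j; rewrite mxE.
  apply: closedI; first exact: closed_unit_cube.
  have /continuous_closedP : continuous res.
    by apply: cts_on_setT; apply: cts_on_prod => j; exact: coord_cts.
  by apply; exact: closed_unit_sphere.
have ch : cts_on (@unit_sphere R J) h.
  rewrite SE; apply: cts_onU => //; first exact: closedU.
    apply: cts_onU => //.
      apply: cts_on_eq hA0 _; apply: cts_on_comp (row_cts _) _ cf.
      by move=> y [Cy _]; exact: row_cube.
    apply: cts_on_eq hA1 _; apply: cts_on_comp (row_cts _) _ cg.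
    by move=> y [Cy _]; exact: row_cube.
  by apply: cts_on_eq hB _; exact: cts_on_cst.
have [|||G [cG GK Gh]] := extK J _ (fun y => set_val (h y)).
- by rewrite card_option card_ord.
- by apply/cts_on_set_val.
- by move=> y _; exact: set_valP.
pose Gx y : X := if pselect (geometric_realisation R K (G y)) is left p
  then SigSub (mem_set p) else x0.
have GxE y : unit_cube y -> set_val (Gx y) = G y.
  by move=> /GK Gy; rewrite /Gx; case: pselect.
have Gxh y : unit_sphere y -> Gx y = h y.
  by move=> Sy; apply: val_inj; rewrite -set_valE GxE ?Gh//; case: Sy.
have packC t s : Defs.cube t -> 0 <= s <= 1 -> unit_cube (pack (t, s)).
  by move=> Ct s01 [j|] //=; exact: Ct.
exists (Gx \o pack); split.
- apply/cts_onP; apply: (cts_on_comp (B := @unit_cube R J)).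
  + apply: cts_on_prod => -[j|] /=.
      apply: (cts_on_comp (B := setT) (f := fst) (g := fun t : 'rV[R]_i => t
        ord0 j)) => //.
        by apply: continuous_cts_on => p; exact: cvg_fst.
      by apply: continuous_cts_on; exact: coord_continuous.
    by apply: continuous_cts_on => p; exact: cvg_snd.
  + by move=> [t s] [/= Ct]; rewrite in_itv/=; exact: packC.
  + apply/cts_on_set_val; apply: cts_on_eq cG => y Cy; by rewrite GxE.
- move=> t Ct /=; have Cp := packC t 0 Ct; rewrite Gxh.
    by rewrite -hA0 ?row_pack//; split; rewrite /= ?lexx//; apply: Cp;
      rewrite lexx ler01.
  rewrite SE; left; left; split=> //=; apply: Cp; by rewrite lexx ler01.
- move=> t Ct /=; have Cp := packC t 1 Ct; rewrite Gxh.
    by rewrite -hA1 ?row_pack//; split; rewrite /= ?lexx//; apply: Cp;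
      rewrite lexx ler01.
  rewrite SE; left; right; split=> //=; apply: Cp; by rewrite lexx ler01.
- move=> t s bt s01 /=; have [Ct _] := bt.
  have Bp : B (pack (t, s)) by split; [exact: packC|rewrite /= row_pack].
  by rewrite Gxh; [rewrite -hB|rewrite SE; right].
Qed.

Lemma homotopy_group_trivial_extendable (x0 : X) :
  spheres_extendable R i.+1 (@realisation R _ K) -> homotopy_group_trivial R i x0.
Proof.
move=> extK.
have c0 : cube_loop x0 (cst x0 : 'rV[R]_i -> X).
  by split=> //; apply/cts_onP; exact: cts_on_cst.
have all_loops (f : 'rV[R]_i -> X) : cube_loop x0 f ->
    loop_class x0 f = [set g : 'rV[R]_i -> X | cube_loop x0 g].
  move=> lf; apply/seteqP; split=> h; first by case.
  by move=> lh; split=> //; exact: loops_homotopic.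
apply/seteqP; split=> C.
  by move=> [f lf <-] /=; rewrite !all_loops.
by move=> ->; exists (cst x0).
Qed.

End LoopsInComplex.

End Loops.

(** * The hypercube *)

Section Hypercube.
Variables n r : nat.
Local Notation hypercube := (n.-tuple bool).
Implicit Types x y : hypercube.

Definition far_count : nat := (\sum_(r.+1 <= i < n.+1) 'C(n, i))%N.

Lemma card_far x : #|[set y | (r < hamming x y)%N]%SET| = far_count.
Proof.
pose diff y := [set j | tnth x j != tnth y j]%SET.
pose flip (A : {set 'I_n}) : hypercube := [tuple tnth x j (+) (j \in A) | j < n].
have flipK : cancel flip diff.
  move=> A; apply/setP => j; rewrite inE tnth_mktuple.
  by case: (tnth x j); case: (j \in A).
have diffK : cancel diff flip.
  move=> y; apply: eq_from_tnth => j; rewrite tnth_mktuple inE.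
  by case: (tnth x j); case: (tnth y j).
have cardA (A : {set 'I_n}) : (#|A| < n.+1)%N.
  by rewrite ltnS -[X in (_ <= X)%N]card_ord max_card.
rewrite -sum1_card (reindex flip) /=; last by exists diff => y _.
under eq_bigl => A do rewrite inE /hamming -/(diff _) flipK.
rewrite (partition_big (fun A : {set 'I_n} => inord #|A| : 'I_n.+1)
  (fun i : 'I_n.+1 => (r < i)%N)) /=; last by move=> A; rewrite inordK.
rewrite /far_count big_geq_mkord; apply: eq_bigr => i ri.
have := card_draws 'I_n i; rewrite card_ord => <-; rewrite sum1_card.
apply: eq_card => A.
rewrite !inE unfold_in -val_eqE /= inordK//.
by case: eqP => [->|]; rewrite ?andbT ?andbF.
Qed.

Lemma common_close (S : {set hypercube}) : (#|S| * far_count < 2 ^ n)%N ->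
  exists w, {in S, forall x, (hamming x w <= r)%N}.
Proof.
move=> Sn; pose far x := [set y | (r < hamming x y)%N]%SET.
have card_union : (#|\bigcup_(x in S) far x|%SET <= #|S| * far_count)%N.
  rewrite -sum_nat_const.
  apply: (@leq_trans (\sum_(x in S) #|far x|)%N); last first.
    by apply: leq_sum => x _; rewrite card_far.
  elim/big_rec2: _ => [|x m A _ IH]; first by rewrite cards0.
  by apply: leq_trans (leq_card_setU _ _) _; rewrite leq_add2l.
have /fintype.subsetPn[w _ wS] : ~~ ([set: hypercube]%SET \subset (\bigcup_(x
  in S) far x)%SET).
  apply/negP => /subset_leq_card; rewrite cardsT card_tuple card_bool => /leq_trans.
  by move=> /(_ _ card_union); rewrite leqNgt Sn.
exists w => x xS; rewrite leqNgt; apply: contra wS => xw.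
by apply/finset.bigcupP; exists x => //; rewrite inE.
Qed.

Definition close x y : bool := (hamming x y <= r)%N.

Lemma close_refl : reflexive close.
Proof. by move=> x; rewrite /close hammingxx. Qed.

Lemma close_sym : symmetric close.
Proof.
move=> x y; rewrite /close /hamming.
by congr (#|pred_of_set _| <= r)%N; apply/setP => j; rewrite !inE eq_sym.
Qed.

Lemma vr_cliques : vr_simplices n r = cliques close [set: hypercube]%SET.
Proof.
apply/setP => s; rewrite !inE finset.subsetT /=; congr (_ && _).
apply/bigmax_leqP/forall_inP => H x xs.
  by apply/forall_inP => y ys; have /bigmax_leqP := H x xs; apply.
by apply/bigmax_leqP => y ys; have /forall_inP := H x xs; apply.
Qed.

Lemma conn_index_lt_alpha : (conn_index n r)%:~R < alpha n r.
Proof.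
rewrite /conn_index; case: ifPn => [aZ|aZ].
  by rewrite intrD floorK// ltrBlDr ltrDl ltr01.
rewrite lt_neqAle floor_le andbT.
by apply: contra aZ => /eqP <-; rewrite intr_int.
Qed.

Lemma conn_index_far_count (i : nat) : (r < n)%N ->
  i%:Z <= conn_index n r - 1 -> (i.+1.*2 * far_count < 2 ^ n)%N.
Proof.
move=> rn ik; have M0 : (0 < far_count)%N.
  by rewrite /far_count big_nat_recr//= binn addn1.
have : (i.+1%:R : rat) < alpha n r.
  apply: le_lt_trans conn_index_lt_alpha.
  by rewrite -[i.+1%:R]/(i.+1%:Z%:~R) ler_int; move: ik; lia.
rewrite /alpha ltr_pdivlMr ?ltr0n// -natrM ltr_nat -/far_count => lt.
have n0 : (0 < n)%N by apply: leq_ltn_trans rn.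
by rewrite -(prednK n0) expnS mul2n -doubleMl ltn_double.
Qed.

End Hypercube.

Theorem mainTheorem1 (R : realType) (n r : nat) (hrn : (r < n)%N) :
  k_connected R (conn_index n r - 1)
    (set_type (geometric_realisation R (vietoris_rips n r))).
Proof.
split=> [|i ik x0].
  pose v : n.-tuple bool := [tuple false | _ < n].
  have Kv : geometric_realisation R (vietoris_rips n r) (vertex_point R v).
    apply/realisationP; first exact: simplex_face.
    exists [set v]%SET; first exact: vr_vertex.
    by apply: vertex_in_simplex; rewrite inE.
  by exists (SigSub (mem_set Kv)).
apply: homotopy_group_trivial_extendable; rewrite /= vr_cliques.
apply: cliques_extendable; [exact: close_refl|exact: close_sym|].
move=> S _ Si; have [|w wS] := @common_close n r S; last by exists w.
by apply: leq_ltn_trans (conn_index_far_count hrn ik); rewrite leq_mul2r Si orbT.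
Qed.
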